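(* Let $d\ge1$ and let $\{a_\alpha\}_{\alpha\in\mathbb{N}_0^d}\subset\mathbb{R}\cup\{\pm\infty\}$ satisfy: (i) $a_\alpha>-\infty$ for all $\alpha\in\mathbb{N}_0^d$; (ii) $\lim_{|\alpha|\to+\infty}a_\alpha/|\alpha|=+\infty$; (iii) $a_\alpha=+\infty$ for at most finitely many $\alpha\in\mathbb{N}_0^d$; (iv) $a_0\in\mathbb{R}$. Let $$F(x):=\sup_{f\in\mathcal{L}_S}f(x),$$ where $\mathcal{L}_S$ is the set of affine functions $f:\mathbb{R}^d\to\mathbb{R}$ such that $f(\alpha)\le a_\alpha$ for all $\alpha\in\mathbb{N}_0^d$. Then $F$, considered on $[0,+\infty)^d$, coincides with the biggest convex function $g:[0,+\infty)^d\to\mathbb{R}$ such that $$g(\alpha)\le a_\alpha,\qquad\forall\alpha\in\mathbb{N}_0^d .$$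
   Context: $\mathbb{N}_0=\mathbb{N}\cup\{0\}$ and $|\alpha|=\alpha_1+\cdots+\alpha_d$ for $\alpha\in\mathbb{N}_0^d$. Affine functions on $\mathbb{R}^d$ are those of the form $f(x)=\langle k,x\rangle+c$ with $k\in\mathbb{R}^d$, $c\in\mathbb{R}$. ''Biggest'' refers to the pointwise order on $[0,+\infty)^d$: the biggest such function is itself a real-valued convex function on $[0,+\infty)^d$ lying below $a_\alpha$ at every $\alpha\in\mathbb{N}_0^d$, and it is pointwise greater than or equal to every other such function. *)

(* Defs.v *)
From mathcomp Require Import all_boot all_order all_algebra.
From mathcomp Require Import all_classical all_reals all_analysis.

Set Implicit Arguments.
Unset Strict Implicit.
Unset Printing Implicit Defensive.

Import Order.TTheory GRing.Theory Num.Theory.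

Local Open Scope classical_set_scope.
Local Open Scope ring_scope.

(* Points of R^d are row vectors over R, multi-indices are row vectors over
   nat; [mpt] is the inclusion of the latter into the former. *)
Definition mabs (d : nat) (alpha : 'rV[nat]_d) : nat :=
  (\sum_(i < d) alpha ord0 i)%N.

Definition mpt (R : realType) (d : nat) (alpha : 'rV[nat]_d) : 'rV[R]_d :=
  \row_(i < d) (alpha ord0 i)%:R.

(* The filter of the limit |alpha| -> +oo. *)
Definition mabs_infty (d : nat) : set_system 'rV[nat]_d :=
  filter_from [set: nat]
    (fun N : nat => [set alpha : 'rV[nat]_d | (N <= mabs alpha)%N]).

#[global] Instance mabs_infty_filter (d : nat) : Filter (@mabs_infty d).
Proof.
apply: filter_from_filter; first by exists 0%N.
move=> M N _ _; exists (maxn M N) => // alpha /=.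
by rewrite geq_max => /andP[].
Qed.

Definition dotrv (R : realType) (d : nat) (k x : 'rV[R]_d) : R :=
  \sum_(i < d) k ord0 i * x ord0 i.

Definition affine_fun (R : realType) (d : nat) (f : 'rV[R]_d -> R) : Prop :=
  exists (k : 'rV[R]_d) (c : R), forall x, f x = dotrv k x + c.

Definition affine_minorants (R : realType) (d : nat)
    (a : 'rV[nat]_d -> \bar R) : set ('rV[R]_d -> R) :=
  [set f | affine_fun f /\ forall alpha, ((f (mpt R alpha))%:E <= a alpha)%E].

(* The supremum is taken in \bar R: it may be +oo off the orthant. *)
Definition sup_affine (R : realType) (d : nat) (a : 'rV[nat]_d -> \bar R)
    (x : 'rV[R]_d) : \bar R :=
  ereal_sup [set (f x)%:E | f in affine_minorants a].

Definition orthant (R : realType) (d : nat) : set 'rV[R]_d :=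
  [set x | forall i, 0 <= x ord0 i].

(* A function [0, +oo)^d -> R is represented by any extension of it to R^d:
   only its values on the orthant are ever used. *)
Definition convex_minorant (R : realType) (d : nat) (a : 'rV[nat]_d -> \bar R)
    (g : 'rV[R]_d -> R) : Prop :=
  @convex_function R 'rV[R]_d (@orthant R d) g /\
  forall alpha, ((g (mpt R alpha))%:E <= a alpha)%E.

Definition biggest_convex_minorant (R : realType) (d : nat)
    (a : 'rV[nat]_d -> \bar R) (g : 'rV[R]_d -> R) : Prop :=
  convex_minorant a g /\
  forall h, convex_minorant a h -> forall x, orthant x -> h x <= g x.

(* Main.v *)
Require Import Defs.
From mathcomp Require Import all_boot all_order all_algebra.
From mathcomp Require Import all_classical all_reals all_analysis.
From mathcomp Require Import ring lra.

Import Order.TTheory GRing.Theory Num.Theory.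

Local Open Scope classical_set_scope.
Local Open Scope ring_scope.

(** Every affine minorant is a convex minorant, so the supremum [F] of the
    affine minorants, once known to be finite on the orthant, is a convex
    minorant there, and it only remains to show that it dominates every convex
    minorant [h]. This is obtained in a strong form ([supporting_affine]): for
    each point [x] of the orthant, boundary points included, some affine
    minorant takes the value [h x] at [x].

    Such a minorant is a slope [k] solving the linear inequalities
    [<k, alpha - x> <= a alpha - h x], one for each multi-index. Finitely many
    of them always have a common solution ([finite_supporting_slope]): otherwise
    Farkas' lemma ([farkas], proved by Fourier-Motzkin elimination) gives
    weights [lam >= 0] with [sum lam (alpha - x) = 0] and
    [sum lam (a alpha - h x) < 0], which contradicts Jensen's inequality for [h]
    ([jensen_barycenter]).

    The infinitely many remaining inequalities come for free. The inequalities
    at [0] and at the points [M e_i], with [M] large compared with [x], already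
    bound every coordinate of [k] from above ([slope_le]), by a constant [B]
    that depends neither on [k] nor on the other inequalities. Only an upper
    bound matters, because multi-indices have nonnegative coordinates: it gives
    [<k, alpha> <= B |alpha|], and superlinear growth of [a] yields the
    inequality at [alpha] as soon as [|alpha|] exceeds a threshold known before
    [k] is chosen. So [k] is taken to solve the finitely many inequalities below
    that threshold. No lower bound on [k] is available in general: for [x] on
    the boundary of the orthant, the set of admissible slopes is unbounded.

    As for the finiteness of [F], superlinear growth makes [a] bounded below,
    hence gives a constant minorant, and [F x < +oo] because [x] is a convex
    combination of [0] and the [M e_i], where [a] is finite
    ([affine_minorant_le]). *)

(** * Farkas' lemma by Fourier-Motzkin elimination *)

Lemma separating_value (F : realFieldType) (J : finType) (P Q : pred J)
    (v : J -> F) :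
  (forall p q, P p -> Q q -> v q <= v p) ->
  exists m, (forall p, P p -> m <= v p) /\ (forall q, Q q -> v q <= m).
Proof.
move=> PQ; case: (pickP Q) => [q0 Qq0|Q0].
  have [q Qq qmax] := arg_maxP v Qq0.
  by exists (v q); split=> [p Pp|]; [exact: PQ|exact: qmax].
case: (pickP P) => [p0 Pp0|P0].
  have [p Pp pmin] := arg_minP v Pp0.
  by exists (v p); split=> [|q]; [exact: pmin|rewrite Q0].
by exists 0; split=> j; rewrite ?P0 ?Q0.
Qed.

(** One step of Fourier-Motzkin elimination in a system of linear inequalities
    indexed by [J], [l] being the coefficients of the unknown to eliminate. The
    new inequalities are indexed by all the pairs [w] in [J * J]. A pair with
    [l w.1 > 0 > l w.2] carries the combination that cancels the unknown; a pair
    with [l w.1 = 0] repeats the inequality [w.1]; the other pairs carry the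
    trivial inequality [0 <= 0]. *)
Section FourierMotzkin.
Context {F : realFieldType} {J : finType} (l : J -> F).

Definition elim_fst (w : J * J) : F :=
  if (0 < l w.1) && (l w.2 < 0) then - l w.2 else (l w.1 == 0)%:R.

Definition elim_snd (w : J * J) : F :=
  if (0 < l w.1) && (l w.2 < 0) then l w.1 else 0.

Definition elim (v : J -> F) (w : J * J) : F :=
  elim_fst w * v w.1 + elim_snd w * v w.2.

Lemma elim_fst_ge0 w : 0 <= elim_fst w.
Proof.
by rewrite /elim_fst; case: ifP => [/andP[_ ?]|_]; [lra|rewrite ler0n].
Qed.

Lemma elim_snd_ge0 w : 0 <= elim_snd w.
Proof. by rewrite /elim_snd; case: ifP => [/andP[? _]|_]; [lra|]. Qed.

Lemma elim_self w : elim l w = 0.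
Proof.
rewrite /elim /elim_fst /elim_snd; case: ifP => _; first by ring.
by case: eqVneq => [->|_]; rewrite ?mulr0 ?mul0r addr0.
Qed.

(** The transpose of [elim]: it turns multipliers for the new system into
    multipliers for the old one, see [elim_adjP]. *)
Definition elim_adj (mu : J * J -> F) (j : J) : F :=
  \sum_w mu w * elim (fun i => (i == j)%:R) w.

Lemma elim_adj_ge0 mu j : (forall w, 0 <= mu w) -> 0 <= elim_adj mu j.
Proof.
move=> mu0; apply: sumr_ge0 => w _; apply: mulr_ge0 => //.
by rewrite addr_ge0 ?mulr_ge0 ?elim_fst_ge0 ?elim_snd_ge0 ?ler0n.
Qed.

Lemma elim_adjP mu v : \sum_j elim_adj mu j * v j = \sum_w mu w * elim v w.
Proof.
have pick i : v i = \sum_j (i == j)%:R * v j.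
  rewrite (bigD1 i) //= eqxx mul1r big1 ?addr0 // => j.
  by rewrite eq_sym => /negbTE ->; rewrite mul0r.
under eq_bigr do rewrite mulr_suml.
rewrite exchange_big; apply: eq_bigr => w _ /=.
rewrite /elim (pick w.1) (pick w.2) !mulr_sumr -big_split mulr_sumr /=.
by apply: eq_bigr => j _; ring.
Qed.

(** The combined inequalities say exactly that each lower bound [r q / l q]
    on the eliminated unknown is below each upper bound [r p / l p], so a value
    in between can be chosen. *)
Lemma elim_sol (r : J -> F) :
  (forall w, 0 <= elim r w) -> exists m, forall j, m * l j <= r j.
Proof.
move=> r0.
have [p q lp lq|m [mP mQ]] := @separating_value F J (fun j => 0 < l j)
    (fun j => l j < 0) (fun j => r j / l j).
  have := r0 (p, q); rewrite /elim /elim_fst /elim_snd /= lp lq /= => H.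
  rewrite ler_ndivrMr // mulrAC ler_pdivrMr //; lra.
exists m => j; have [lj|lj|lj] := ltgtP (l j) 0.
- by rewrite -ler_ndivrMr //; exact: mQ.
- by rewrite -ler_pdivlMr //; exact: mP.
have := r0 (j, j).
by rewrite /elim /elim_fst /elim_snd /= lj ltxx eqxx /= mul1r mul0r mulr0 addr0.
Qed.

End FourierMotzkin.

(** Induction on the number of unknowns: a solution of the system where the
    first unknown has been eliminated extends by [elim_sol], and a certificate
    of its infeasibility is pulled back by [elim_adj], which cancels the first
    column by [elim_self]. *)
Lemma farkas (F : realFieldType) (n : nat) (J : finType) (u : J -> 'I_n -> F)
    (t : J -> F) :
  (exists k : 'I_n -> F, forall j, \sum_i k i * u j i <= t j) \/
  (exists lam : J -> F, [/\ forall j, 0 <= lam j,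
     forall i, \sum_j lam j * u j i = 0 & \sum_j lam j * t j < 0]).
Proof.
elim: n J u t => [|n IHn] J u t.
  have [t0|] := boolP [forall j, 0 <= t j].
    by left; exists (fun=> 0) => j; rewrite big_ord0; exact: (forallP t0).
  rewrite negb_forall => /existsP[j0]; rewrite -ltNge => tj0; right.
  exists (fun j => (j == j0)%:R); split=> [j|[]//|]; first exact: ler0n.
  rewrite (bigD1 j0) //= eqxx mul1r big1 ?addr0 // => j /negbTE ->.
  by rewrite mul0r.
pose l j := u j ord0.
case: (IHn _ (fun w i => elim l (fun j => u j (lift ord0 i)) w) (elim l t)).
- case=> k kP; left.
  have [w|m mP] := elim_sol l
      (fun j => t j - \sum_i k i * u j (lift ord0 i)).
    have := kP w; rewrite /elim -subr_ge0; congr (0 <= _).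
    under eq_bigr do rewrite mulrDr !(mulrCA (k _)).
    by rewrite big_split /= -!mulr_sumr; ring.
  exists (fun i => oapp k m (unlift ord0 i)) => j.
  rewrite big_ord_recl unlift_none /= -lerBrDr.
  by under [X in _ - X]eq_bigr do rewrite liftK /=; exact: mP.
- case=> mu [mu0 mul mut]; right; exists (elim_adj l mu); split.
  + by move=> j; exact: elim_adj_ge0.
  + move=> i; rewrite (elim_adjP l mu (fun j => u j i)).
    case: (unliftP ord0 i) => [i'|] -> //.
    by apply: big1 => w _; rewrite (elim_self l w) mulr0.
  + by rewrite elim_adjP.
Qed.

(** * Jensen's inequality *)

Lemma convex_functionP (R : realType) (E : lmodType R) (D : set E)
    (f : E -> R) :
  @convex_function R E D f <->
  forall x y (t : R), D x -> D y -> 0 <= t <= 1 ->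
    f (t *: x + (1 - t) *: y) <= t * f x + (1 - t) * f y.
Proof.
split=> [cf x y t Dx Dy /andP[t0 t1]|cf t x y /set_mem Dx /set_mem Dy].
  exact: (cf (Itv01 t0 t1) x y (mem_set Dx) (mem_set Dy)).
by apply: cf => //; rewrite ge0 le1.
Qed.

Lemma convex_setP (R : realType) (E : lmodType R) (D : set E) :
  @convex_set R E D <->
  forall x y (t : R), D x -> D y -> 0 <= t <= 1 -> D (t *: x + (1 - t) *: y).
Proof.
split=> [cD x y t Dx Dy /andP[t0 t1]|cD x y t /set_mem Dx /set_mem Dy].
  exact: set_mem (cD x y (Itv01 t0 t1) (mem_set Dx) (mem_set Dy)).
by apply: mem_set; apply: cD => //; rewrite ge0 le1.
Qed.

Lemma orthant_convex (R : realType) (d : nat) :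
  @convex_set R 'rV[R]_d (@orthant R d).
Proof.
apply/convex_setP => x y t x0 y0 /andP[t0 t1] i.
by rewrite !mxE addr_ge0 ?mulr_ge0 ?subr_ge0.
Qed.

(** Jensen's inequality for the weights [w] at [x] and [lam j] at [p j],
    multiplied by the total weight. Singling out one strictly positive weight
    keeps the total weight positive along the induction, which absorbs one
    point of [s] after the other into [x]. *)
Lemma jensen (R : realType) (E : lmodType R) (D : set E) (f : E -> R)
    (J : Type) (s : seq J) (lam : J -> R) (p : J -> E) (w : R) (x : E) :
  @convex_set R E D -> @convex_function R E D f ->
  (forall j, 0 <= lam j) -> (forall j, D (p j)) -> 0 < w -> D x ->
  (w + \sum_(j <- s) lam j) * f ((w + \sum_(j <- s) lam j)^-1 *:
    (w *: x + \sum_(j <- s) lam j *: p j)) <=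
  w * f x + \sum_(j <- s) lam j * f (p j).
Proof.
move=> /convex_setP cD /convex_functionP cf lam0 Dp.
elim: s w x => [|j s IHs] w x w0 Dx /=.
  by rewrite !big_nil !addr0 scalerA mulVf ?scale1r // gt_eqF.
rewrite !big_cons.
set v := w + lam j; have v0 : 0 < v by rewrite ltr_wpDr.
have vE : 1 - w / v = lam j / v by rewrite /v; field; exact: lt0r_neq0.
have wv : 0 <= w / v <= 1.
  apply/andP; split; first by apply: divr_ge0; exact: ltW.
  by rewrite ler_pdivrMr // mul1r lerDl.
pose y := (w / v) *: x + (1 - w / v) *: p j.
have := IHs v y v0 (cD _ _ _ Dx (Dp j) wv).
have -> : v *: y = w *: x + lam j *: p j.
  by rewrite scalerDr !scalerA vE !(mulrC v) !divfK // gt_eqF.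
rewrite !addrA -/v => /le_trans; apply; rewrite lerD2r.
have := cf _ _ _ Dx (Dp j) wv.
rewrite -/y -(ler_pM2l v0) vE => /le_trans; apply.
by rewrite mulrDr !mulrA !(mulrC v) !mulfK // gt_eqF.
Qed.

(** The weights [lam] are not normalized and may all vanish: adding the
    barycenter [x] itself with weight 1 to the family does not move the
    barycenter and makes the total weight positive. *)
Lemma jensen_barycenter (R : realType) (E : lmodType R) (D : set E) (f : E -> R)
    (J : finType) (lam : J -> R) (p : J -> E) (x : E) :
  @convex_set R E D -> @convex_function R E D f ->
  (forall j, 0 <= lam j) -> (forall j, D (p j)) -> D x ->
  \sum_j lam j *: (p j - x) = 0 -> 0 <= \sum_j lam j * (f (p j) - f x).
Proof.
move=> cD cf lam0 Dp Dx bary.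
have := jensen R E D f J (index_enum J) lam p 1 x cD cf lam0 Dp ltr01 Dx.
have -> : \sum_j lam j *: p j = (\sum_j lam j) *: x.
  apply/eqP; rewrite -subr_eq0; apply/eqP.
  rewrite scaler_suml -sumrB -[RHS]bary.
  by apply: eq_bigr => j _; rewrite scalerBr.
have L0 : 0 <= \sum_j lam j by exact: sumr_ge0.
rewrite -scalerDl scalerA mulVf ?scale1r; last by rewrite gt_eqF // ltr_wpDr.
under [X in _ -> 0 <= X]eq_bigr do rewrite mulrBr.
by rewrite sumrB -mulr_suml => /=; lra.
Qed.

(** * Multi-indices and growth *)

Definition superlinear {R : realType} {d : nat} (a : 'rV[nat]_d -> \bar R) :=
  forall A : R, exists N : nat, forall alpha, (N <= mabs alpha)%N ->
    ((A * (mabs alpha)%:R)%:E <= a alpha)%E.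

Lemma superlinear_of_cvg (R : realType) (d : nat) (a : 'rV[nat]_d -> \bar R) :
  (a alpha / ((mabs alpha)%:R)%:E)%E @[alpha --> @mabs_infty d] --> +oo%E ->
  superlinear a.
Proof.
move=> /cvgeyPge acvg A; have [N _ NP] := acvg A.
exists N.+1 => alpha Nalpha.
have m0 : 0 < (mabs alpha)%:R :> R by rewrite ltr0n (leq_trans _ Nalpha).
have := NP alpha (ltnW Nalpha); rewrite /= inver gt_eqF //.
by rewrite lee_pdivlMr // EFinM.
Qed.

Definition axis (d : nat) (M : nat) (i : 'I_d) : 'rV[nat]_d :=
  \row_j (if j == i then M else 0%N).

Lemma mabs_axis d M (i : 'I_d) : mabs (axis d M i) = M.
Proof.
rewrite /mabs (bigD1 i) //= mxE eqxx big1 ?addn0 // => j /negbTE ji.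
by rewrite mxE ji.
Qed.

Lemma mpt_orthant (R : realType) d (alpha : 'rV[nat]_d) :
  orthant (mpt R alpha).
Proof. by move=> i; rewrite mxE. Qed.

Lemma dotrv_axis (R : realType) d M (i : 'I_d) (k : 'rV[R]_d) :
  dotrv k (mpt R (axis d M i)) = k ord0 i * M%:R.
Proof.
rewrite /dotrv (bigD1 i) //= !mxE eqxx big1 ?addr0 // => j /negbTE ji.
by rewrite !mxE ji mulr0.
Qed.

Lemma dotrv_mpt0 (R : realType) d (k : 'rV[R]_d) : dotrv k (mpt R 0) = 0.
Proof. by rewrite /dotrv big1 // => i _; rewrite !mxE mulr0. Qed.

Lemma leq_mabs d (alpha : 'rV[nat]_d) i : (alpha ord0 i <= mabs alpha)%N.
Proof. by rewrite /mabs (bigD1 i) //= leq_addr. Qed.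

Lemma dotrv_mpt_le (R : realType) d (k : 'rV[R]_d) B (alpha : 'rV[nat]_d) :
  (forall i, k ord0 i <= B) -> dotrv k (mpt R alpha) <= B * (mabs alpha)%:R.
Proof.
move=> kB; rewrite /mabs natr_sum mulr_sumr; apply: ler_sum => i _.
by rewrite mxE ler_wpM2r.
Qed.

(** The cube [{0, ..., N}^d] as a finite type: it contains all the
    multi-indices with [|alpha| <= N] and is easier to enumerate. *)
Definition box_index (d N : nat) (b : 'rV['I_N.+1]_d) : 'rV[nat]_d :=
  map_mx (@nat_of_ord _) b.

Lemma box_indexP d N (alpha : 'rV[nat]_d) :
  (mabs alpha <= N)%N -> exists b, alpha = box_index d N b.
Proof.
move=> alphaN; exists (\row_i inord (alpha ord0 i)).
apply/rowP => i; rewrite !mxE inordK // ltnS.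
exact: leq_trans (leq_mabs _ _ _) alphaN.
Qed.

Lemma finite_axis (R : realType) (d : nat) (a : 'rV[nat]_d -> \bar R) (r : R) :
  (forall alpha, (-oo < a alpha)%E) ->
  finite_set [set alpha | a alpha = +oo%E] ->
  exists M : nat, r <= M%:R /\ forall i, a (axis d M i) \is a fin_num.
Proof.
move=> agt /finite_seqP[s sE].
pose N := (\sum_(alpha <- s) mabs alpha)%N.
exists (maxn N.+1 (Num.bound `|r|)); split=> [|i].
  rewrite (le_trans (ler_norm r)) //.
  rewrite (le_trans (ltW (Num.Theory.archi_boundP _))) //.
  by rewrite ler_nat leq_maxr.
set alpha := axis _ _ _; rewrite fin_numElt agt ltey; apply/eqP => aoo.
have : alpha \in s by have : [set` s] alpha by rewrite -sE.
move=> /(perm_to_rem)/(perm_big _)/= sumE.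
have : (mabs alpha <= N)%N by rewrite /N sumE big_cons leq_addr.
by rewrite mabs_axis leqNgt => /negP; apply; rewrite leq_max leqnn.
Qed.

Lemma superlinear_lbound (R : realType) (d : nat) (a : 'rV[nat]_d -> \bar R) :
  (forall alpha, (-oo < a alpha)%E) -> superlinear a ->
  exists m : R, forall alpha, (m%:E <= a alpha)%E.
Proof.
move=> agt /(_ 0)[N NP].
exists (- \sum_b `|fine (a (box_index d N b))|) => alpha.
have [Na|aN] := leqP N (mabs alpha).
  apply: (le_trans _ (NP _ Na)).
  by rewrite mul0r lee_fin oppr_le0 sumr_ge0.
have [->|afin] := eqVneq (a alpha) +oo%E; first exact: leey.
have /fineK <- : a alpha \is a fin_num by rewrite fin_numElt agt ltey.
have [b ->] := box_indexP d N alpha (ltnW aN).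
rewrite lee_fin (bigD1 b) //= opprD.
rewrite -[leRHS]addr0 lerD ?oppr_le0 ?sumr_ge0 //.
by rewrite lerNl -normrN ler_norm.
Qed.

(** * Affine minorants *)

(** For [M] at least the sum of the coordinates of [x], the point [x] is the
    barycenter of the [M e_i], with weights [x_i / M], and of [0]; an affine
    function is controlled at [x] by its values at these points. *)
Lemma affine_minorant_le (R : realType) (d : nat) (a : 'rV[nat]_d -> \bar R)
    (x : 'rV[R]_d) :
  (forall alpha, (-oo < a alpha)%E) ->
  finite_set [set alpha | a alpha = +oo%E] ->
  a 0 \is a fin_num -> orthant x ->
  exists K, forall f, affine_minorants a f -> f x <= K.
Proof.
move=> agt afin a0 x0; pose X := \sum_i x ord0 i.
have [M [XM aM]] := finite_axis R d a (X + 1) agt afin.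
have X0 : 0 <= X by exact: sumr_ge0.
have M0 : 0 < M%:R :> R by lra.
exists ((\sum_i x ord0 i * fine (a (axis d M i)) + (M%:R - X) * fine (a 0))
  / M%:R) => f [[k [c fE]] fa].
rewrite ler_pdivlMr // fE.
have c0 : c <= fine (a 0).
  by have := fa 0; rewrite fE dotrv_mpt0 add0r -(fineK a0) lee_fin.
have kM i : k ord0 i * M%:R + c <= fine (a (axis d M i)).
  by have := fa (axis d M i); rewrite fE dotrv_axis -(fineK (aM i)) lee_fin.
have -> : (dotrv k x + c) * M%:R =
    \sum_i x ord0 i * (k ord0 i * M%:R + c) + (M%:R - X) * c.
  under [X in _ = X + _]eq_bigr do rewrite mulrDr mulrA (mulrC (x _ _)).
  by rewrite big_split /= -!mulr_suml -/X /dotrv; ring.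
apply: lerD; first by apply: ler_sum => i _; exact: ler_wpM2l.
by apply: ler_wpM2l => //; lra.
Qed.

(** With [s = <k, x>], weighting the bounds [k_i M <= C + s] by [x_i] gives
    [s M <= (sum x_i) (C + s)]. As [sum x_i] is at most [M / 2], this bounds [s]
    by [C], and then [k_i M] by [2 C]. *)
Lemma slope_le (R : realType) (d : nat) (k x : 'rV[R]_d) (M C : R) :
  orthant x -> 0 < M -> 2 * \sum_i x ord0 i <= M ->
  - dotrv k x <= C -> (forall i, k ord0 i * M - dotrv k x <= C) ->
  forall i, k ord0 i <= 2 * C / M.
Proof.
move=> x0 M0 XM sC kC i; set s := dotrv k x in sC kC *.
suff sleC : s <= C by rewrite ler_pdivlMr //; have := kC i; lra.
have : s * M <= (\sum_i x ord0 i) * (C + s).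
  rewrite /s {1}/dotrv !mulr_suml; apply: ler_sum => j _.
  rewrite mulrAC mulrC; apply: ler_wpM2l => //.
  by have := kC j; rewrite -/s; lra.
have : 0 <= (M - 2 * \sum_i x ord0 i) * (C + s) by apply: mulr_ge0; lra.
move=> h1 h2; rewrite -(ler_pM2r M0); lra.
Qed.

(** The indices where [a] is infinite carry no constraint; they are left out of
    the index type [J] of the system, whose right-hand sides are then real. *)
Lemma finite_supporting_slope (R : realType) (d : nat)
    (a : 'rV[nat]_d -> \bar R) (h : 'rV[R]_d -> R) (x : 'rV[R]_d) (N : nat) :
  (forall alpha, (-oo < a alpha)%E) -> convex_minorant a h -> orthant x ->
  exists k : 'rV[R]_d, forall alpha, (mabs alpha <= N)%N ->
    ((dotrv k (mpt R alpha) - dotrv k x + h x)%:E <= a alpha)%E.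
Proof.
move=> agt [cvx_h ha] x0.
pose J : finType := {b | a (box_index d N b) \is a fin_num}.
pose p (j : J) := mpt R (box_index d N (val j)).
case: (farkas R d J (fun j i => (p j - x) ord0 i)
    (fun j => fine (a (box_index d N (val j))) - h x)).
  case=> k kP; exists (\row_i k i) => alpha alphaN.
  have [->|afin] := eqVneq (a alpha) +oo%E; first exact: leey.
  have {}afin : a alpha \is a fin_num by rewrite fin_numElt agt ltey.
  have [b alphaE] := box_indexP d N alpha alphaN.
  have afin' := afin; rewrite alphaE in afin'.
  have := kP (exist (fun b => a (box_index d N b) \is a fin_num) b afin').
  rewrite /p /= -alphaE lerBrDr.
  rewrite -[in X in _ -> X](fineK afin) lee_fin; congr (_ + _ <= _).
  by rewrite /dotrv -sumrB; apply: eq_bigr => i _; rewrite !mxE mulrBr.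
case=> lam [lam0 bary]; rewrite ltNge => /negP[].
have : \sum_j lam j *: (p j - x) = 0.
  apply/rowP => i; rewrite summxE mxE -[RHS](bary i).
  by apply: eq_bigr => j _; rewrite mxE.
move=> /(jensen_barycenter R _ _ h J lam p x (orthant_convex R d) cvx_h lam0).
move=> jen; apply: (le_trans (jen _ _)) => // [j|]; first exact: mpt_orthant.
apply: ler_sum => j _; apply: ler_wpM2l => //; rewrite lerD2r -lee_fin.
by rewrite fineK ?ha //; exact: (valP j).
Qed.

(** A convex [h] may jump at the boundary of the orthant and have no subgradient
    there, so the slope is fitted to the values of [a] at the multi-indices
    rather than to [h]: only the value [h x] enters the inequalities. *)
Lemma supporting_affine (R : realType) (d : nat) (a : 'rV[nat]_d -> \bar R)
    (h : 'rV[R]_d -> R) (x : 'rV[R]_d) :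
  (forall alpha, (-oo < a alpha)%E) -> superlinear a ->
  finite_set [set alpha | a alpha = +oo%E] -> a 0 \is a fin_num ->
  convex_minorant a h -> orthant x ->
  exists2 f, affine_minorants a f & f x = h x.
Proof.
move=> agt asup afin a0 hmin x0.
have [M [XM aM]] := finite_axis R d a (2 * (\sum_i x ord0 i) + 1) agt afin.
have X0 : 0 <= \sum_i x ord0 i by exact: sumr_ge0.
have M0 : 0 < M%:R :> R by lra.
have [C [Cge0 C0 CM]] : exists C : R, [/\ 0 <= C, fine (a 0) - h x <= C &
    forall i, fine (a (axis d M i)) - h x <= C].
  exists (`|fine (a 0) - h x| + \sum_i `|fine (a (axis d M i)) - h x|).
  split=> [||i]; rewrite ?addr_ge0 ?sumr_ge0 // (le_trans (ler_norm _)) //.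
    by rewrite lerDl sumr_ge0.
  by rewrite (bigD1 i) //= addrCA lerDl addr_ge0 // sumr_ge0.
(* Beyond [N] the growth of [a] has to beat the slope bound [2 C / M] plus the
   constants [C] and [`|h x|]; these are multiplied by [mabs alpha >= 1]. *)
have [N NP] := asup (2 * C / M%:R + C + `|h x|).
(* Taking [M] into account makes the constraints at the points [M e_i] part of
   the finite system. *)
have [k kP] := finite_supporting_slope R d a h x (maxn M N.+1) agt hmin x0.
have k0 : - dotrv k x <= C.
  have := kP 0; rewrite dotrv_mpt0 -(fineK a0) lee_fin /mabs.
  rewrite big1 => [|i _]; last by rewrite mxE.
  by move=> /(_ isT); lra.
have kM i : k ord0 i * M%:R - dotrv k x <= C.
  have := kP (axis d M i); rewrite dotrv_axis -(fineK (aM i)) lee_fin.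
  by rewrite mabs_axis leq_maxl => /(_ isT); have := CM i; lra.
have kB := slope_le R d k x M%:R C x0 M0 (ltac:(lra)) k0 kM.
exists (fun y => dotrv k y + (h x - dotrv k x)); last by ring.
split=> [|alpha]; first by exists k, (h x - dotrv k x).
have [small|] := leqP (mabs alpha) (maxn M N.+1).
  by rewrite addrCA addrC kP.
rewrite gtn_max => /andP[_ /ltnW large].
apply: le_trans (NP alpha (ltnW large)); rewrite lee_fin.
have m1 : 1 <= (mabs alpha)%:R :> R by rewrite ler1n (leq_trans _ large).
have := dotrv_mpt_le R d k _ alpha kB.
have : (C + `|h x|) * 1 <= (C + `|h x|) * (mabs alpha)%:R.
  by apply: ler_wpM2l => //; rewrite addr_ge0.
have := ler_norm (h x).
set m := (mabs alpha)%:R; set B := 2 * C / M%:R; set hx := `|h x|.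
rewrite !mulrDl; lra.
Qed.

Theorem theorem4p1 (R : realType) (d : nat) (hd : (1 <= d)%N)
    (a : 'rV[nat]_d -> \bar R)
    (a_gtNy : forall alpha, (-oo < a alpha)%E)
    (a_superlinear :
       (a alpha / ((mabs alpha)%:R)%:E)%E @[alpha --> @mabs_infty d] --> +oo%E)
    (a_fin : finite_set [set alpha | a alpha = +oo%E])
    (a0_fin : a 0 \is a fin_num) :
  exists2 g : 'rV[R]_d -> R,
    biggest_convex_minorant a g &
    forall x, orthant x -> sup_affine a x = (g x)%:E.
Proof.
have asup := superlinear_of_cvg R d a a_superlinear.
pose g x := fine (sup_affine a x).
have minorant_le_sup f x :
    affine_minorants a f -> ((f x)%:E <= sup_affine a x)%E.
  by move=> fa; apply: ereal_sup_ubound; exists f.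
have gE x : orthant x -> sup_affine a x = (g x)%:E.
  move=> x0; rewrite fineK // fin_numElt; apply/andP; split.
    have [m mP] := superlinear_lbound R d a a_gtNy asup.
    apply: lt_le_trans (ltNyr m) _; apply: (minorant_le_sup (fun=> m)).
    split=> //; exists 0, m => y.
    by rewrite /dotrv big1 ?add0r // => i _; rewrite mxE mul0r.
  have [K KP] := affine_minorant_le R d a x a_gtNy a_fin a0_fin x0.
  apply: le_lt_trans (ltry K).
  by apply: ge_ereal_sup => _ [f fa <-]; rewrite lee_fin KP.
exists g => //; split; last first.
  move=> h hmin x x0.
  have [f fa <-] :=
    supporting_affine R d a h x a_gtNy asup a_fin a0_fin hmin x0.
  by rewrite -lee_fin -gE // minorant_le_sup.
split; last first.
  move=> alpha; rewrite -gE; last exact: mpt_orthant.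
  by apply: ge_ereal_sup => _ [f [_ fa] <-].
apply/convex_functionP => x y t x0 y0 t01.
have /andP[t0 t1] := t01.
rewrite -lee_fin -gE; last by have /convex_setP := orthant_convex R d; apply.
apply: ge_ereal_sup => _ [f fa <-]; rewrite lee_fin.
have gf z : orthant z -> f z <= g z.
  by move=> z0; rewrite -lee_fin -gE // minorant_le_sup.
have [[k [c fE]] _] := fa.
have -> : f (t *: x + (1 - t) *: y) = t * f x + (1 - t) * f y.
  rewrite !fE.
  have -> : dotrv k (t *: x + (1 - t) *: y) =
      t * dotrv k x + (1 - t) * dotrv k y.
    rewrite /dotrv !mulr_sumr -big_split; apply: eq_bigr => i _ /=.
    by rewrite !mxE; ring.
  by ring.
by apply: lerD; apply: ler_wpM2l; rewrite ?subr_ge0 ?gf.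
Qed.
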